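(* Let $\mathcal{C}$ be any nice clustering for a facility location instance $(F,D)$. Then the solution defined by $\mathcal{C}$ (open exactly the facilities $i$ with $\mathcal{C}(i)\neq\emptyset$ and assign each client to the facility of the unique cluster of $\mathcal{C}$ containing it) has cost at most $O(1)$ times the optimum cost of the instance, where the $O(1)$ is an absolute constant.
   Context: Facility location: finite facility set $F$, finite client set $D$, in a common metric space; $d_{ij}>0$ is the distance between facility $i$ and client $j$ (triangle inequality holds), $f_i\ge0$ the opening cost of facility $i$. A solution opens $F'\subseteq F$ and assigns each client $j$ to an open facility $i_j$; its cost is $\sum_{i\in F'} f_i+\sum_{j\in D}d_{i_j j}$. Clusters: a cluster is a pair $C=(i,A)$ with $i\in F$, $A\subseteq D$, designated either critical or satellite; satellite clusters have exactly one client. $cost(C)=\sum_{j\in A}d_{ij}$ if $C$ is satellite and $cost(C)=f_i+\sum_{j\in A}d_{ij}$ if critical; $cost_{avg}(C)=cost(C)/|A|$. A clustering is a collection $\mathcal{C}$ of clusters such that every client of $D$ belongs to exactly one cluster of $\mathcal{C}$, and for each facility $i$, if the set $\mathcal{C}(i)$ of clusters of $\mathcal{C}$ with facility $i$ is nonempty then exactly one cluster of $\mathcal{C}(i)$ is critical. Every cluster $C\in\mathcal{C}$ has an integer level $\ell(C)\in\mathbb{Z}$, and for a client $j$ in $C$ we put $\ell(j)=\ell(C)$. For $i\in F,j\in D$, $\kappa^*_{ij}$ is the unique integer with $2^{\kappa^*_{ij}-4}\le d_{ij}<2^{\kappa^*_{ij}-3}$. Blocking cluster: a cluster $C=(i,A)$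 (not necessarily in $\mathcal{C}$) is blocking at level $k\in\mathbb{Z}$ w.r.t. $\mathcal{C}$ if (a) $cost_{avg}(C)<2^{k-3}$; (b) for every $j\in A$, $\ell(j)>k\ge\kappa^*_{ij}$; (c) if $C$ is satellite, there is a critical cluster $C^*\in\mathcal{C}(i)$ with $\ell(C^* )\le k$, and if $C$ is critical, then $k\le\ell(C')$ for all $C'\in\mathcal{C}(i)$. Nice clustering: $\mathcal{C}$ is nice if (I1) $cost_{avg}(C)<2^{\ell(C)}$ for all $C\in\mathcal{C}$; (I2) for each facility $i$ with $\mathcal{C}(i)\ne\emptyset$, the critical cluster $C^*\in\mathcal{C}(i)$ satisfies $\ell(C^* )\le\ell(C)$ for all $C\in\mathcal{C}(i)$; (I3) for every $C=(i,A)\in\mathcal{C}$ and $j\in A$, $\ell(j)\ge\kappa^*_{ij}$; (I4) there is no blocking cluster w.r.t. $\mathcal{C}$ at any level $k\in\mathbb{Z}$. *)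

(* Defs.v *)
From HB Require Import structures.
From mathcomp Require Import all_boot all_order all_algebra.
From mathcomp Require Import all_classical all_reals all_analysis.

Set Implicit Arguments.
Unset Strict Implicit.
Unset Printing Implicit Defensive.

Import Order.TTheory GRing.Theory Num.Theory.

Local Open Scope ring_scope.

(* Facilities and clients are indexed by finite types, so several of them may
   share a location; dist_gt0 only separates facilities from clients. *)
Record instance (R : realType) := Instance {
  facility : finType;
  client : finType;
  space : metricType R;
  facility_loc : facility -> space;
  client_loc : client -> space;
  opening_cost : facility -> R;
  opening_cost_ge0 : forall i, 0 <= opening_cost i;
  dist_gt0 : forall i j, 0 < mdist (facility_loc i) (client_loc j)
}.

Definition dist (R : realType) (I : instance R)
    (i : facility I) (j : client I) : R :=
  mdist (facility_loc i) (client_loc j).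

Record solution (R : realType) (I : instance R) := Solution {
  opened : {set facility I};
  assign : client I -> facility I;
  assign_opened : forall j, assign j \in opened
}.

Definition solution_cost (R : realType) (I : instance R)
    (s : solution I) : R :=
  \sum_(i in opened s) opening_cost i + \sum_j dist (assign s j) j.

(* The infimum is over finitely many values, hence a minimum, as soon as a
   solution exists. *)
Definition optimum_cost (R : realType) (I : instance R) : R :=
  inf (range (@solution_cost R I)).

(* A triple ((i, A), b) encodes the cluster (i, A), critical if b is true and
   satellite otherwise. A is nonempty: the average cost divides by #|A|. *)
Definition is_cluster (F D : finType) (x : F * {set D} * bool) : bool :=
  (x.1.2 != finset.set0) && (~~ x.2 ==> (#|x.1.2| == 1)%N).

Record cluster (F D : finType) := Cluster {
  cluster_val : F * {set D} * bool;
  clusterP : is_cluster cluster_val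
}.

HB.instance Definition _ (F D : finType) :=
  [isSub for (@cluster_val F D)].
HB.instance Definition _ (F D : finType) :=
  [Finite of cluster F D by <:].

Section ClusterProjections.
Variables F D : finType.
Implicit Type C : cluster F D.

Definition cfac C : F := (cluster_val C).1.1.
Definition members C : {set D} := (cluster_val C).1.2.
Definition critical C : bool := (cluster_val C).2.
Definition satellite C : bool := ~~ critical C.

Lemma members_neq0 C : members C != finset.set0.
Proof. by case/andP: (clusterP C). Qed.

Lemma satellite_card C : satellite C -> #|members C| = 1%N.
Proof. by case/andP: (clusterP C) => _ /implyP h /h /eqP. Qed.

End ClusterProjections.

Section Clusterings.
Variables (R : realType) (I : instance R).
Local Notation F := (facility I).
Local Notation D := (client I).

Definition cluster_cost (C : cluster F D) : R :=
  (if critical C then opening_cost (cfac C) else 0)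
  + \sum_(j in members C) dist (cfac C) j.

Definition cluster_cost_avg (C : cluster F D) : R :=
  cluster_cost C / #|members C|%:R.

Definition clusters_at (S : {set cluster F D}) (i : F) : {set cluster F D} :=
  finset (fun C => (C \in S) && (cfac C == i)).

(* As clusters are nonempty and every client is in exactly one of them, a
   collection of clusters has no repetition. Only the levels of the clusters in
   the collection matter. *)
Record clustering := Clustering {
  clusters : {set cluster F D};
  level : cluster F D -> int;
  client_covered : forall j : D,
    exists! C, C \in clusters /\ j \in members C;
  one_critical : forall i : F,
    clusters_at clusters i != finset.set0 ->
    exists! C, C \in clusters_at clusters i /\ critical C
}.

Lemma cluster_ofP (CC : clustering) (j : D) :
  exists C, (C \in clusters CC) && (j \in members C).
Proof.
by have [C [[h1 h2] _]] := client_covered CC j; exists C; rewrite h1 h2.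
Qed.

Definition cluster_of (CC : clustering) (j : D) : cluster F D :=
  xchoose (cluster_ofP CC j).

Definition client_level (CC : clustering) (j : D) : int :=
  level CC (cluster_of CC j).

Lemma cluster_of_opened (CC : clustering) (j : D) :
  cfac (cluster_of CC j) \in
    finset (fun i => clusters_at (clusters CC) i != finset.set0).
Proof.
have /andP[h _] := xchooseP (cluster_ofP CC j).
by rewrite inE; apply/set0Pn; exists (cluster_of CC j); rewrite inE h eqxx.
Qed.

Definition clustering_solution (CC : clustering) : solution I :=
  {| opened := finset (fun i => clusters_at (clusters CC) i != finset.set0);
     assign := fun j => cfac (cluster_of CC j);
     assign_opened := cluster_of_opened CC |}.

Definition is_kappa (i : F) (j : D) (k : int) : Prop :=
  (2 : R) ^ (k - 4) <= dist i j < (2 : R) ^ (k - 3).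

Lemma is_kappa_ex_unique (i : F) (j : D) : exists! k, is_kappa i j k.
Proof.
have d0 : 0 < dist i j := dist_gt0 i j.
have ln20 : 0 < ln 2 :> R by rewrite ln_gt0// ltr1n.
have expE (z : int) : (2 : R) ^ z = expR (z%:~R * ln 2).
  by rewrite -powR_intmul// /powR pnatr_eq0.
have lnE : dist i j = expR (ln (dist i j)) by rewrite lnK.
have kE k : is_kappa i j k <-> Num.floor (ln (dist i j) / ln 2) = k - 4.
  rewrite /is_kappa !expE lnE ler_expR ltr_expR -ler_pdivlMr// -ltr_pdivrMr//.
  have -> : k - 3 = k - 4 + 1 by rewrite -addrA.
  rewrite expRK.
  by split=> [h|<-]; [exact: floor_def | exact: floor_itv].
exists (Num.floor (ln (dist i j) / ln 2) + 4); split.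
  by apply/kE; rewrite addrK.
by move=> k /kE ->; rewrite subrK.
Qed.

Definition kappa (i : F) (j : D) : int := xget 0 (is_kappa i j).

Lemma kappaP (i : F) (j : D) : is_kappa i j (kappa i j).
Proof.
by apply: xgetPex; have [k [hk _]] := is_kappa_ex_unique i j; exists k.
Qed.

Definition blocking (CC : clustering) (C : cluster F D) (k : int) : Prop :=
  [/\ cluster_cost_avg C < 2 ^ (k - 3),
      forall j, j \in members C ->
        k < client_level CC j /\ kappa (cfac C) j <= k,
      satellite C -> exists C',
        [/\ C' \in clusters_at (clusters CC) (cfac C), critical C' & level CC C' <= k]
    & critical C -> forall C',
        C' \in clusters_at (clusters CC) (cfac C) -> k <= level CC C'].

Definition nice (CC : clustering) : Prop :=
  [/\ forall C, C \in clusters CC -> cluster_cost_avg C < 2 ^ level CC C,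
      forall i C' C, C' \in clusters_at (clusters CC) i -> critical C' ->
        C \in clusters_at (clusters CC) i -> level CC C' <= level CC C,
      forall C j, C \in clusters CC -> j \in members C ->
        kappa (cfac C) j <= client_level CC j
    & forall C k, ~ blocking CC C k].

End Clusterings.

(* Main.v *)
Require Import Defs.
From mathcomp Require Import all_boot all_order all_algebra.
From mathcomp Require Import all_classical all_reals all_analysis.
From mathcomp Require Import lra zify.

Import Order.TTheory GRing.Theory Num.Theory.

Local Open Scope ring_scope.

(** By (I1), the cost of the clustering is at most the sum of [2 ^ l(j)] over
    the clients [j]. This sum is charged separately to each facility [i] of an
    arbitrary solution, with its set [A] of assigned clients. A client with
    [l(j) <= kappa_ij] satisfies [2 ^ l(j) <= 16 d_ij]. Let [B] be the set of
    the other clients of [A], and [m] the minimal level in [B], attained at [j0].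
    - The facility of the cluster of [j0] has a critical cluster of level at
      most [m], so no satellite cluster there blocks; with the triangle
      inequality through [i] this gives [2 ^ l(j) <= 3 * 2 ^ m + 16 d_ij]
      for [j] in [B].
    - The clients of [B] with [kappa_ij < m] form a critical cluster at [i]
      which does not block at level [m - 1], so their number times [2 ^ m] is at
      most [16 (f_i + \sum_j d_ij)]; the other clients of [B] satisfy
      [2 ^ m <= 16 d_ij]. *)

Section PowersOfTwo.
Variable R : realType.
Implicit Types k m : int.

Lemma exp2z_gt0 k : 0 < (2 : R) ^ k.
Proof. exact: exprz_gt0. Qed.

Lemma exp2z_le k m : ((2 : R) ^ k <= 2 ^ m) = (k <= m).
Proof. by rewrite ler_eXz2l // ltr1n. Qed.

Lemma exp2zB k (n : nat) : (2 : R) ^ (k - n%:Z) = 2 ^ k / 2 ^+ n.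
Proof. by rewrite expfzDr // -exprnN. Qed.

End PowersOfTwo.

Section NiceClustering.
Variables (R : realType) (I : instance R) (CC : clustering I).
Local Notation F := (facility I).
Local Notation D := (client I).
Implicit Types (i : F) (j : D) (A : {set D}).

Lemma dist_ge0 i j : 0 <= dist i j.
Proof. exact/ltW/dist_gt0. Qed.

Lemma dist_quadrangle i i' j j' :
  dist i' j' <= dist i' j + dist i j + dist i j'.
Proof.
rewrite /dist -addrA.
apply: (le_trans (metric_triangle _ (client_loc j) _)); rewrite lerD2l.
apply: (le_trans (metric_triangle _ (facility_loc i) _)).
by rewrite (metric_sym (client_loc j)).
Qed.

Lemma exp2_kappa_le i j : 2 ^ kappa i j <= 16 * dist i j.
Proof.
have /andP[h _] := kappaP i j; move: h.
by rewrite (exp2zB _ _ 4) ler_pdivrMr ?exprn_gt0 // mulrC -natrX.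
Qed.

Lemma dist_lt_exp2_kappa i j k : kappa i j <= k -> dist i j < 2 ^ (k - 3).
Proof.
have /andP[_ h] := kappaP i j; move=> le_k.
by apply: (lt_le_trans h); rewrite exp2z_le lerD2r.
Qed.

Lemma cluster_ofE C j :
  C \in clusters CC -> (j \in members C) = (cluster_of CC j == C).
Proof.
move=> CS; have /andP[h1 h2] := xchooseP (cluster_ofP CC j).
apply/idP/eqP => [jC|<-//].
have [C0 [_ uC0]] := client_covered CC j.
by rewrite -(uC0 C) // -(uC0 (cluster_of CC j)).
Qed.

Lemma cluster_of_in j : cluster_of CC j \in clusters CC.
Proof. by have /andP[] := xchooseP (cluster_ofP CC j). Qed.

Lemma mem_cluster_of j : j \in members (cluster_of CC j).
Proof. by have /andP[] := xchooseP (cluster_ofP CC j). Qed.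

Lemma sum_clusters (G : Defs.cluster F D -> D -> R) :
  \sum_(C in clusters CC) \sum_(j in members C) G C j
  = \sum_j G (cluster_of CC j) j.
Proof.
rewrite [RHS](partition_big (cluster_of CC) (mem (clusters CC))) /=; last first.
  by move=> j _; exact: cluster_of_in.
apply: eq_bigr => C CS; apply: eq_big => [j|j]; first by rewrite cluster_ofE.
by rewrite cluster_ofE // => /eqP ->.
Qed.

Lemma exists_critical i C : C \in clusters_at (clusters CC) i ->
  exists2 C', C' \in clusters_at (clusters CC) i & critical C'.
Proof.
move=> Ci; have /one_critical[C' [[C'i critC'] _]] :
  clusters_at (clusters CC) i != finset.set0 by apply/set0Pn; exists C.
by exists C'.
Qed.

(** Each opened facility has a critical cluster, and that cluster pays its opening cost. *)
Lemma opening_costs_le_critical :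
  \sum_(i in opened (clustering_solution CC)) opening_cost i
  <= \sum_(C in clusters CC)
       (if critical C then opening_cost (cfac C) else 0).
Proof.
rewrite [leRHS](partition_big (@cfac F D)
  (mem (opened (clustering_solution CC)))) /=; last first.
  move=> C CS; rewrite inE; apply/set0Pn; exists C.
  by rewrite inE CS eqxx.
apply: ler_sum => i; rewrite inE => /one_critical[C [[]]].
rewrite inE => /andP[CS /eqP Ci] critC _.
rewrite (bigD1 C) /= ?CS ?Ci ?eqxx // critC lerDl.
by apply: sumr_ge0 => C' _; case: ifP => // _; exact: opening_cost_ge0.
Qed.

Hypothesis niceCC : nice CC.

(** This is (I1) times the size of [C], written as a sum over members so that [sum_clusters] turns
    the total into a sum over clients. *)
Lemma cluster_cost_le C : C \in clusters CC ->
  cluster_cost C <= \sum_(j in members C) 2 ^ level CC C.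
Proof.
have [I1 _ _ _] := niceCC => CS.
have n0 : (0 : R) < #|members C|%:R.
  by rewrite ltr0n card_gt0 members_neq0.
have := I1 C CS; rewrite /cluster_cost_avg ltr_pdivrMr // => /ltW.
by rewrite sumr_const mulr_natr.
Qed.

Lemma clustering_cost_le :
  solution_cost (clustering_solution CC) <= \sum_j 2 ^ client_level CC j.
Proof.
rewrite /client_level -(sum_clusters (fun C _ => 2 ^ level CC C)).
apply: (@le_trans _ _ (\sum_(C in clusters CC) cluster_cost C)); last first.
  exact: ler_sum cluster_cost_le.
rewrite big_split /= (sum_clusters (fun C j => dist (cfac C) j)) lerD2r.
exact: opening_costs_le_critical.
Qed.

(* Otherwise the satellite cluster on [j] at [i] would block. *)
Lemma client_level_le i j C :
  C \in clusters_at (clusters CC) i -> critical C ->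
  client_level CC j <= Order.max (kappa i j) (level CC C).
Proof.
have [_ _ _ I4] := niceCC => Ci critC.
(* The least [k] meeting both demands on a satellite: [kappa i j <= k] and a critical cluster at [i]
   of level at most [k]. *)
set k := Order.max _ _; rewrite leNgt; apply/negP => lt_k.
have clP : is_cluster ((i, [set j]%SET), false).
  by rewrite /is_cluster /= cards1 eqxx -card_gt0 cards1.
pose S := Cluster clP.
apply: (I4 S k); split => //.
- rewrite /cluster_cost_avg /cluster_cost /critical /members /cfac /=.
  rewrite big_set1 cards1 divr1 add0r; apply: dist_lt_exp2_kappa.
  by rewrite le_max lexx.
- rewrite /members /cfac /= => j' /set1P ->; split => //.
  by rewrite le_max lexx.
- by move=> _; exists C; split => //; rewrite le_max lexx orbT.
Qed.

(* Otherwise the critical cluster on [A] at [i] would block. *)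
Lemma critical_charge i A (k : int) :
  (forall j, j \in A -> k < client_level CC j /\ kappa i j <= k) ->
  (forall C, C \in clusters_at (clusters CC) i -> k <= level CC C) ->
  #|A|%:R * 2 ^ (k - 3) <= opening_cost i + \sum_(j in A) dist i j.
Proof.
have [_ _ _ I4] := niceCC => hA hk.
have [->|A0] := eqVneq A finset.set0.
  by rewrite cards0 mul0r big_set0 addr0 opening_cost_ge0.
have clP : is_cluster ((i, A), true) by rewrite /is_cluster /= A0.
have n0 : (0 : R) < #|A|%:R by rewrite ltr0n card_gt0.
rewrite leNgt; apply/negP => lt_cost.
apply: (I4 (Cluster clP) k); split => //.
rewrite /cluster_cost_avg /cluster_cost /critical /members /cfac /=.
by rewrite ltr_pdivrMr // mulrC.
Qed.

Lemma exp2_level_le i j j' :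
  kappa i j < client_level CC j ->
  client_level CC j <= client_level CC j' ->
  (2 : R) ^ client_level CC j' <= 3 * 2 ^ client_level CC j + 16 * dist i j'.
Proof.
have [_ I2 I3 _] := niceCC => kj le_jj'.
set l := client_level CC j.
have l0 : 0 < (2 : R) ^ l := exp2z_gt0 _ _.
have [le_l|lt_l] := leP (client_level CC j') l.
  have : (2 : R) ^ client_level CC j' <= 2 ^ l by rewrite exp2z_le.
  have := dist_ge0 i j'.
  by move: l0; move: (_ ^ l) (_ ^ client_level CC j') => x y; lra.
pose C := cluster_of CC j; pose i' := cfac C.
have Ci' : C \in clusters_at (clusters CC) i'.
  by rewrite inE cluster_of_in eqxx.
have [C' C'i' critC'] := exists_critical _ _ Ci'.
have le_C' : level CC C' <= l := I2 _ _ _ C'i' critC' Ci'.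
have := client_level_le i' j' C' C'i' critC'.
rewrite le_max => /orP[|le']; last first.
  by move: lt_l; rewrite ltNge (le_trans le' le_C').
rewrite -(exp2z_le R) => h.
have h1 := exp2_kappa_le i' j'.
have h2 := dist_quadrangle i i' j j'.
(* The factor 3 is 16 * (1/8 + 1/16): (I3) gives [dist i' j < 2 ^ (l - 3)], and the strict
   [kappa i j < l] gives [dist i j < 2 ^ (l - 4)]. *)
have /dist_lt_exp2_kappa : kappa i' j <= l.
  by apply: I3 (cluster_of_in j) (mem_cluster_of j).
have /dist_lt_exp2_kappa : kappa i j <= l - 1 by lia.
rewrite -addrA -opprD (exp2zB _ _ 4) (exp2zB _ _ 3).
move: h h1 h2 l0; rewrite -!natrX.
by move: (_ ^ l) (_ ^ client_level CC j') (_ ^ kappa i' j') => x y z; lra.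
Qed.

Lemma exp2_levels_charge i A :
  \sum_(j in A) (2 : R) ^ client_level CC j
  <= 64 * (opening_cost i + \sum_(j in A) dist i j).
Proof.
have [_ I2 _ _] := niceCC.
have f0 := opening_cost_ge0 i.
have d0 (P : pred D) : 0 <= \sum_(j | P j) dist i j.
  by apply: sumr_ge0 => j _; exact: dist_ge0.
pose b := [pred j | kappa i j < client_level CC j].
rewrite (bigID b) /= [in leRHS](bigID b) /=.
have small : \sum_(j in A | ~~ b j) (2 : R) ^ client_level CC j
             <= 16 * \sum_(j in A | ~~ b j) dist i j.
  rewrite mulr_sumr; apply: ler_sum => j /andP[_].
  rewrite /= -leNgt => le_k; apply: le_trans (exp2_kappa_le i j).
  by rewrite exp2z_le.
(* Here 48 = 3 * 16 comes from bounding 3 times the sum of [2 ^ m], and 64 = 48 + 16 adds the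
   distance term of [exp2_level_le]. *)
suff large : \sum_(j in A | b j) (2 : R) ^ client_level CC j
             <= 48 * opening_cost i + 64 * \sum_(j in A | b j) dist i j.
  have := d0 (fun j => (j \in A) && ~~ b j); move: small large => /=.
  by move: (\sum_(j in A | _) 2 ^ _) (\sum_(j in A | ~~ _) 2 ^ _) => x y; lra.
have [j1 j1B|B0] := pickP (fun j => (j \in A) && b j); last first.
  by rewrite !big_pred0 // mulr0 addr0 mulr_ge0.
have [j0 /andP[j0A bj0] j0min] := 
  @arg_minP _ _ _ j1 (fun j => (j \in A) && b j) (client_level CC) j1B.
set m := client_level CC j0 in j0min.
have step1 : \sum_(j in A | b j) (2 : R) ^ client_level CC j
    <= 3 * (\sum_(j in A | b j) 2 ^ m) + 16 * \sum_(j in A | b j) dist i j.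
  rewrite !mulr_sumr -big_split; apply: ler_sum => j jB.
  exact: exp2_level_le bj0 (j0min j jB).
(* Blocking needs a level strictly below all client levels, and [m - 1] is the largest such;
   [2 ^ (m - 1 - 3)] then yields the factor 16. *)
pose n := [pred j | kappa i j <= m - 1].
have far : \sum_(j in A | b j && ~~ n j) (2 : R) ^ m
    <= 16 * \sum_(j in A | b j && ~~ n j) dist i j.
  rewrite mulr_sumr; apply: ler_sum => j /and3P[_ _] /= nk.
  by apply: le_trans (exp2_kappa_le i j); rewrite exp2z_le; lia.
pose B' := finset (fun j => [&& j \in A, b j & n j]).
have near : \sum_(j in A | b j && n j) (2 : R) ^ m
    <= 16 * (opening_cost i + \sum_(j in A | b j && n j) dist i j).
  have /(critical_charge i B') : forall j, j \in B' ->
      m - 1 < client_level CC j /\ kappa i j <= m - 1.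
    move=> j; rewrite inE => /and3P[jA bj nj]; split => //.
    by have := j0min j; rewrite jA bj => /(_ isT); lia.
  (* Since [kappa i j0 < m], [client_level_le] for [j0] forces the critical cluster at [i] to level
     at least [m]; (I2) extends this to every cluster at [i]. *)
  have lvl C : C \in clusters_at (clusters CC) i -> m - 1 <= level CC C.
    move=> Ci; have [C' C'i critC'] := exists_critical _ _ Ci.
    have := client_level_le i j0 C' C'i critC'.
    have := I2 _ _ _ C'i critC' Ci; move: bj0; rewrite /b /= -/m.
    by rewrite le_max => ? ? /orP[]; lia.
  move=> /(_ lvl).
  rewrite -addrA -opprD (exp2zB _ _ 4) -natrX mulr_natl -sumr_const.
  rewrite -mulr_suml.
  rewrite !(eq_bigl (fun j => (j \in A) && (b j && n j)) _
    (fun j => finset.in_set _ j)).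
  by rewrite /=; move: (\sum_(j | _) _ ^ m) => x; lra.
have split_n (G : D -> R) : \sum_(j in A | b j) G j =
    \sum_(j in A | b j && n j) G j + \sum_(j in A | b j && ~~ n j) G j.
  by rewrite (bigID n); congr (_ + _); apply: eq_bigl => j; rewrite andbA.
move: step1 near far; rewrite (split_n (fun _ => 2 ^ m)) (split_n (dist i)).
move: (\sum_(j in A | b j) _) (\sum_(j in A | b j && n j) 2 ^ m)
  (\sum_(j in A | b j && ~~ n j) 2 ^ m) => x y z.
have := d0 (fun j => (j \in A) && (b j && n j)); rewrite /=; lra.
Qed.

Lemma clustering_cost_le_solution (s : solution I) :
  solution_cost (clustering_solution CC) <= 64 * solution_cost s.
Proof.
apply: (le_trans clustering_cost_le).
have as_in j : true -> assign s j \in opened s.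
  by move=> _; exact: assign_opened.
rewrite (partition_big (assign s) (mem (opened s)) as_in) /=.
rewrite /solution_cost.
rewrite [X in _ + X](partition_big (assign s) (mem (opened s)) as_in) /=.
rewrite -big_split mulr_sumr; apply: ler_sum => i _ /=.
have := exp2_levels_charge i (finset (fun j => assign s j == i)).
rewrite !(eq_bigl (fun j => assign s j == i) _ (fun j => finset.in_set _ j)).
suff -> : \sum_(j | assign s j == i) dist (assign s j) j
          = \sum_(j | assign s j == i) dist i j by [].
by apply: eq_bigr => j /eqP ->.
Qed.

End NiceClustering.

Theorem theorem2 (R : realType) :
  exists c : R, forall (I : instance R) (CC : clustering I),
    nice CC ->
    solution_cost (clustering_solution CC) <= c * optimum_cost I.
Proof.
exists 64 => I CC niceCC.
rewrite mulrC -ler_pdivrMr //; apply: lb_le_inf.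
  (* The infimum is over a nonempty set: the solution of [CC] itself is a witness. *)
  by exists (solution_cost (clustering_solution CC)), (clustering_solution CC).
move=> _ [s _ <-]; rewrite ler_pdivrMr // mulrC.
exact: clustering_cost_le_solution.
Qed.
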